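(* Let $\mathbf{t}$ be the Thue--Morse sequence. Then: (a) for all $n\ge 0$, $r_{\mathbf{t}}(2n+1) = \rho_{\mathbf{t}}(n + 1)$; (b) for all $n \geq 2$, \[ r_{\mathbf{t}}(2 n) = \begin{cases} \rho_{\mathbf{t}}(n+1) + 1, & \text{if there exists } m\ge 0 \text{ with } 3 \cdot 4^{m-1} + 1 \leq n \leq 4^{m}, \\ \rho_{\mathbf{t}}(n+1), & \text{otherwise}; \end{cases} \] (c) there is a deterministic finite automaton with output having $14$ states that, reading the base-$2$ representation of $n$, outputs $r_{\mathbf{t}}(n+1)-r_{\mathbf{t}}(n)$; in particular this first-difference sequence is $2$-automatic.
   Context: The Thue--Morse sequence is $\mathbf{t}=t(0)t(1)t(2)\cdots = 0110100110010110\cdots$, where $t(n)$ is the number of $1$'s in the base-$2$ expansion of $n$, taken modulo $2$. A factor is a finite contiguous block. For $u=u(1)\cdots u(m)$, $u^R=u(m)\cdots u(1)$. $\rho_{\mathbf{t}}(n)$ is the number of distinct length-$n$ factors of $\mathbf{t}$, and $r_{\mathbf{t}}(n)$ is the number of distinct length-$n$ factors up to the equivalence $u\sim v\iff v\in\{u,u^R\}$. *)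

(* Defs.v *)
From mathcomp Require Import all_boot all_order all_algebra.
From mathcomp Require Import boolp.

Set Implicit Arguments.
Unset Strict Implicit.
Unset Printing Implicit Defensive.

Import GRing.Theory Num.Theory.

(* The binary digit of n of weight 2 ^ i is odd (n %/ 2 ^ i); since n < 2 ^ n,
   all the nonzero digits have index i < n. *)
Definition ones (n : nat) : nat := \sum_(i < n) odd (n %/ 2 ^ i).

(* The letters 0 and 1 are the booleans false and true. *)
Definition thue_morse (n : nat) : bool := odd (ones n).

Definition factors (A : finType) (x : nat -> A) (n : nat) : {set n.-tuple A} :=
  [set w : n.-tuple A | `[< exists i, w = [tuple x (i + j) | j < n] >] ].

Definition eq_upto_rev (A : finType) (n : nat) : rel (n.-tuple A) :=
  fun u v => (v == u) || (v == [tuple of rev u]).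

Definition subword_complexity (A : finType) (x : nat -> A) (n : nat) : nat :=
  #|factors x n|.

(* A class is the trace on factors x n of an equivalence class of all words of
   length n: x is not assumed to have its factors closed under reversal. *)
Definition reflection_complexity (A : finType) (x : nat -> A) (n : nat) : nat :=
  #|equivalence_partition (@eq_upto_rev A n) (factors x n)|.

Record dfao (k : nat) (B : Type) := Dfao {
  dfao_state : finType;
  dfao_init : dfao_state;
  dfao_trans : dfao_state -> 'I_k -> dfao_state;
  dfao_output : dfao_state -> B
}.

Definition dfao_eval (k : nat) (B : Type) (M : dfao k B) (w : seq 'I_k) : B :=
  dfao_output (foldl (@dfao_trans k B M) (dfao_init M) w).

(* Most significant digit first. *)
Definition digits_value (k : nat) (w : seq 'I_k) : nat :=
  foldl (fun (v : nat) (d : 'I_k) => v * k + d) 0 w.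

(* Leading zeros are allowed: the output must be right on every base-k
   representation of n, in particular on the canonical one (and on both the
   empty word and the word 0 when n = 0). *)
Definition dfao_computes (k : nat) (B : Type) (M : dfao k B) (a : nat -> B) :=
  forall (n : nat) (w : seq 'I_k), digits_value w = n -> dfao_eval M w = a n.

Definition automatic (k : nat) (B : Type) (a : nat -> B) : Prop :=
  exists M : dfao k B, dfao_computes M a.

Definition first_difference (f : nat -> nat) (n : nat) : int :=
  ((f n.+1)%:Z - (f n)%:Z)%R.

(* Main.v *)
Require Import Defs.
From mathcomp Require Import all_boot all_order all_algebra.
From mathcomp Require Import boolp zify.

(** The factors of the Thue-Morse word t are closed under reversal, so
    2 r(N) = rho(N) + Pal(N), where Pal(N) counts the palindromic factors.
    A factor of length N >= 4 unfolds, for a unique parity of its position,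
    from a unique shorter factor under 0 -> 01, 1 -> 10; hence the recurrences
    rho(2n) = rho(n) + rho(n+1) and rho(2n+1) = 2 rho(n+1).  Unfolding exchanges
    palindromes with words equal to their complemented reversal, which yields
    Pal(N) = 0 for odd N >= 5 and, for n >= 7, Pal(2n) = Pal(2 ceil(n/4)).
    The difference rho(n+1) - rho(n) is invariant under n -> ceil(n/4) too, so
    the excess Pal(2n) - (rho(n+1) - rho(n)) is determined by n <= 6.  The same recurrences
    show that finitely many values attached to n determine those attached to
    2n and 2n+1, and this is the automaton. *)

Set Implicit Arguments.
Unset Strict Implicit.
Unset Printing Implicit Defensive.

Import Order.TTheory GRing.Theory Num.Theory.

(** * Binary recursion for the Thue-Morse word and its forbidden patterns *)

Lemma ones_widen (n m : nat) : n <= m -> \sum_(i < m) odd (n %/ 2 ^ i) = ones n.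
Proof.
move=> le_nm; rewrite /ones -(subnKC le_nm) big_split_ord /= [X in _ + X]big1 ?addn0 //.
move=> i _; rewrite divn_small // (leq_trans (ltn_expl n (ltnSn 1))) //.
by rewrite leq_exp2l // leq_addr.
Qed.

Lemma ones_bit (n : nat) (b : bool) : ones (2 * n + b) = b + ones n.
Proof.
have half_nb : (2 * n + b) %/ 2 = n by case: b; lia.
rewrite -(@ones_widen _ (2 * n + b).+1) // big_ord_recl expn0 divn1 oddD oddM /= oddb.
congr (_ + _); rewrite -(@ones_widen n (2 * n + b)); last by lia.
by apply: eq_bigr => i _; rewrite /bump /= expnD expn1 divnMA half_nb.
Qed.

Lemma thue_morse_bit (i n : nat) (b : bool) :
  i = 2 * n + b -> thue_morse i = thue_morse n (+) b.
Proof. by move->; rewrite /thue_morse ones_bit oddD oddb addbC. Qed.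

Lemma nat_bit (k : nat) : exists m (b : bool), k = 2 * m + b.
Proof. by exists k./2, (odd k); lia. Qed.

(** Among three consecutive positions some two are [2 * m] and [2 * m + 1], where the letters are
    complementary. *)
Lemma thue_morse_cube_free (k : nat) :
  thue_morse k = thue_morse k.+1 -> thue_morse k.+1 <> thue_morse k.+2.
Proof.
have [m [[|] ->]] := nat_bit k.
- rewrite (@thue_morse_bit _.+1 m.+1 false); last by lia.
  rewrite (@thue_morse_bit _.+2 m.+1 true); last by lia.
  by case: (thue_morse m.+1).
- rewrite (@thue_morse_bit _ m false) // (@thue_morse_bit _.+1 m true); last by lia.
  by case: (thue_morse m).
Qed.

(** A palindrome of length 5 would come from three equal letters at [m], [m + 1], [m + 2], where [m]
    is half of [k]. *)
Lemma thue_morse_no_palindrome5 (k : nat) :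
  thue_morse k = thue_morse (k + 4) -> thue_morse k.+1 <> thue_morse (k + 3).
Proof.
have [m [b ->]] := nat_bit k.
rewrite (@thue_morse_bit (_.+1) (m + b) (~~ b)); last by case: b; lia.
rewrite (@thue_morse_bit _ m b) // (@thue_morse_bit (_ + 4) m.+2 b); last by lia.
rewrite (@thue_morse_bit (_ + 3) (m + 1 + b) (~~ b)); last by case: b; lia.
have := @thue_morse_cube_free m.
by case: b => /=; rewrite !(addn0, addn1);
  case: (thue_morse m); case: (thue_morse m.+1); case: (thue_morse m.+2) => //= H;
  case: (H erefl).
Qed.

(** * Desubstitution of windows *)

(* A window of the image of w under the morphism 0 -> 01, 1 -> 10, starting at
   position 0 or 1 of that image according to p. *)
Definition unfold (N : nat) (p : bool) (w : seq bool) : seq bool :=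
  mkseq (fun j => nth false w (p + j)./2 (+) odd (p + j)) N.

Definition window (N i : nat) : seq bool := mkseq (fun j => thue_morse (i + j)) N.

(** The number of letters whose images cover the positions below [N + p]. *)
Definition parent_size (N : nat) (p : bool) : nat := uphalf (N + p).

Lemma size_window N i : size (window N i) = N.
Proof. exact: size_mkseq. Qed.

Lemma nth_window N i j : j < N -> nth false (window N i) j = thue_morse (i + j).
Proof. exact: nth_mkseq. Qed.

Lemma window_unfold N k (p : bool) :
  window N (2 * k + p) = unfold N p (window (parent_size N p) k).
Proof.
apply/eq_in_map => j; rewrite mem_iota add0n => /= ltjN.
rewrite nth_window /parent_size; last by lia.
by apply: thue_morse_bit; lia.
Qed.

Lemma unfold_inj N p (v w : seq bool) :
  0 < N -> size v = parent_size N p -> size w = parent_size N p ->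
  unfold N p v = unfold N p w -> v = w.
Proof.
rewrite /parent_size => N0 sv sw eqvw; apply: (@eq_from_nth _ false); first by rewrite sv.
move=> i lti; have [j ltjN ij] : exists2 j, j < N & (p + j)./2 = i.
  (* For [i = 0] and [p = 1] the truncated subtraction gives position 0, which still lies over
     letter 0. *)
  by exists (2 * i - p); case: p {eqvw} sv sw; lia.
have := congr1 (nth false ^~ j) eqvw; rewrite !nth_mkseq // ij.
exact: addIb.
Qed.

(** On the even side the letters 0, 1 and the letters 2, 3 are complementary pairs, on the odd side
    the letters 1, 2 are; a coincidence would thus alternate, forcing equal letters at [l], [l + 1],
    [l + 2]. *)
Lemma window_parity N k l : 4 <= N -> window N (2 * k) <> window N (2 * l + 1).
Proof.
move=> N4 eqw.
have E j : j < N -> thue_morse (2 * k + j) = thue_morse (2 * l + 1 + j).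
  by move=> ltjN; rewrite -(nth_window _ ltjN) eqw nth_window.
have := (E 0, E 1, E 2, E 3).
rewrite (@thue_morse_bit (2 * k + 0) k false); last by lia.
rewrite (@thue_morse_bit (2 * k + 1) k true); last by lia.
rewrite (@thue_morse_bit (2 * k + 2) k.+1 false); last by lia.
rewrite (@thue_morse_bit (2 * k + 3) k.+1 true); last by lia.
rewrite (@thue_morse_bit (2 * l + 1 + 0) l true); last by lia.
rewrite (@thue_morse_bit (2 * l + 1 + 1) l.+1 false); last by lia.
rewrite (@thue_morse_bit (2 * l + 1 + 2) l.+1 true); last by lia.
rewrite (@thue_morse_bit (2 * l + 1 + 3) l.+2 false); last by lia.
move=> [[[/(_ (ltac:(lia))) E0 /(_ (ltac:(lia))) E1] /(_ (ltac:(lia))) E2] /(_ (ltac:(lia))) E3].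
have := @thue_morse_cube_free l; move: E0 E1 E2 E3.
by case: (thue_morse l); case: (thue_morse l.+1); case: (thue_morse l.+2);
   case: (thue_morse k); case: (thue_morse k.+1) => //= _ _ _ _ H; case: (H erefl).
Qed.

(** * Reversal and complemented reversal *)

Definition crev (c : bool) (w : seq bool) : seq bool := [seq b (+) c | b <- rev w].

Lemma size_crev c w : size (crev c w) = size w.
Proof. by rewrite size_map size_rev. Qed.

Lemma nth_crev c w j : j < size w ->
  nth false (crev c w) j = nth false w (size w - j.+1) (+) c.
Proof. by move=> ltj; rewrite (nth_map false) ?size_rev // nth_rev. Qed.

Lemma crev_unfold N p c w : size w = parent_size N p ->
  crev c (unfold N p w) = unfold N (p (+) odd N) (crev (~~ c) w).
Proof.
rewrite /parent_size => sw; apply: (@eq_from_nth _ false).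
  by rewrite size_crev !size_mkseq.
move=> j; rewrite size_crev size_mkseq => ltj.
rewrite nth_crev size_mkseq // !nth_mkseq ?nth_crev ?sw; try by case: p sw; lia.
rewrite -!addbA; congr addb; first by congr nth; case: p sw; lia.
by case: c; case: p sw => /=; lia.
Qed.

Lemma parent_size_odd N p : 0 < N -> parent_size N (p (+) odd N) = parent_size N p.
Proof. by rewrite /parent_size; case: p => /=; lia. Qed.

(** Induction through the parent window, for both values of [c] at once since each step flips
    [c]. *)
Lemma crev_window N i c : exists k, crev c (window N i) = window N k.
Proof.
elim/ltn_ind: N i c => -[|[|[|N]]] IH i c.
- by exists 0.
- exists (thue_morse i (+) c : nat).
  rewrite /crev /window /mkseq /= !addn0.
  by case: (_ (+) _); rewrite /thue_morse /ones ?big_ord_recr !big_ord0.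
(* At an odd position a window of length 2 has a parent of length 2, so the induction cannot start
   here; all four pairs are exhibited instead. *)
- have [k Ek] : exists k, [:: thue_morse k; thue_morse k.+1]
                        = [:: thue_morse i.+1 (+) c; thue_morse i (+) c].
    case: (thue_morse i.+1 (+) c); case: (thue_morse i (+) c).
    + by exists 1; rewrite /thue_morse /ones !big_ord_recr !big_ord0.
    + by exists 2; rewrite /thue_morse /ones !big_ord_recr !big_ord0.
    + by exists 0; rewrite /thue_morse /ones !big_ord_recr !big_ord0.
    + by exists 5; rewrite /thue_morse /ones !big_ord_recr !big_ord0.
  by exists k; rewrite /crev /window /mkseq /= !addn0 !addn1 Ek.
- have [m [p ->]] := nat_bit i.
  rewrite window_unfold crev_unfold ?size_window //.
  have [|k ->] := IH (parent_size N.+3 p) _ m (~~ c).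
    by rewrite /parent_size; case: p; lia.
  rewrite -(@parent_size_odd N.+3 p) // -window_unfold.
  by eexists.
Qed.

(** * Counting reflection classes and factors *)

(** A class is either one palindrome or two non-palindromes, so with palindromes counted twice every
    class contributes 2. *)
Lemma reflection_complexity_palindromes (A : finType) (x : nat -> A) (n : nat) :
  {in factors x n, forall w : n.-tuple A, [tuple of rev w] \in factors x n} ->
  2 * reflection_complexity x n =
  subword_complexity x n + #|[set w in factors x n | tval w == rev w]|.
Proof.
rewrite /reflection_complexity /subword_complexity.
move: (factors x n) => F rev_closed; set P := equivalence_partition _ F.
have eqv : {in F & &, equivalence_rel (@eq_upto_rev A n)}.
  move=> u v w _ _ _; rewrite /eq_upto_rev eqxx; split=> //.
  case/orP => /eqP -> //.
  have -> : [tuple of rev [tuple of rev u]] = u by apply: val_inj; rewrite /= revK.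
  by rewrite orbC.
have partP := equivalence_partitionP eqv.
have [/eqP covP trivP nset0] := and3P partP.
have cardE_sum (B : {set n.-tuple A}) :
    #|B| + #|[set w in B | tval w == rev w]| = \sum_(w in B) (1 + (tval w == rev w)).
  rewrite big_split /= sum1_card; congr (_ + _).
  by rewrite -sum1dep_card big_mkcondr; apply: eq_bigr => w _; case: (_ == _).
rewrite cardE_sum -[in RHS]covP (big_trivIset _ trivP) /= mulnC -sum_nat_const.
apply: eq_bigr => B /imsetP[w wF ->]; rewrite -cardE_sum.
have rwF := rev_closed _ wF.
have -> : [set y in F | eq_upto_rev w y] = [set w; [tuple of rev w]].
  apply/setP => y; rewrite !inE /eq_upto_rev andb_idl //.
  by case/orP => /eqP ->.
have [/eqP pal|npal] := boolP (w == [tuple of rev w]).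
  have -> : [set w; [tuple of rev w]] = [set w] by rewrite -pal setUid.
  rewrite cards1 (_ : [set _ in _ | _] = [set w]) ?cards1 //.
  apply/setP => y; rewrite !inE andb_idr // => /eqP ->.
  by rewrite {1}pal.
rewrite cards2 npal (_ : [set _ in _ | _] = set0) ?cards0 //.
apply/setP => y; rewrite !inE; apply/negP => /andP[/orP[]/eqP-> /eqP /= palw].
  by case/eqP: npal; apply: val_inj.
by rewrite revK in palw; case/eqP: npal; apply: val_inj.
Qed.

Lemma mem_factors N (w : N.-tuple bool) :
  reflect (exists i, tval w = window N i) (w \in factors thue_morse N).
Proof.
have E i : tval [tuple thue_morse (i + j) | j < N] = window N i.
  by rewrite /= /window /mkseq -val_enum_ord -map_comp.
by rewrite inE; apply/(iffP (asboolP _)) => -[i wi]; exists i;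
  [rewrite wi E | apply: val_inj; rewrite /= wi -E].
Qed.

Lemma in_sep (T : finType) (F : {set T}) (P : pred T) w :
  (w \in [set x in F | P x]) = (w \in F) && P w.
Proof. exact: in_set. Qed.

(** Each factor comes from exactly one offset and parent: [window_parity] separates the offsets and
    [unfold_inj] the parents. The predicate [P] lets one bijection serve both complexity and
    symmetric factors. *)
Lemma card_factors_unfold N (P : pred (seq bool)) : 4 <= N ->
  #|[set w in factors thue_morse N | P w]| =
  #|[set v in factors thue_morse (parent_size N false) | P (unfold N false v)]| +
  #|[set v in factors thue_morse (parent_size N true) | P (unfold N true v)]|.
Proof.
move=> N4.
pose f p (v : (parent_size N p).-tuple bool) := [tuple of unfold N p v].
pose A p := [set v in factors thue_morse (parent_size N p) | P (unfold N p v)].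
have f_inj p : injective (f p).
  move=> v w /(congr1 val) eqvw; apply: val_inj; apply: unfold_inj eqvw;
    by rewrite ?size_tuple //; lia.
have -> : [set w in factors thue_morse N | P w] = f false @: A false :|: f true @: A true.
  apply/setP => w; rewrite in_setU; apply/idP/idP.
    rewrite in_sep => /andP[/mem_factors[i wi] Pw].
    have [k [p ik]] := nat_bit i; rewrite ik window_unfold in wi.
    have wf : w \in f p @: A p.
      have sz : size (window (parent_size N p) k) == parent_size N p by rewrite size_window.
      apply/imsetP; exists (Tuple sz); last by apply: val_inj.
      by rewrite in_sep /= -wi Pw andbT; apply/mem_factors; exists k.
    by case: (p) wf => ->; rewrite ?orbT.
  have sub p : w \in f p @: A p -> w \in [set w in factors thue_morse N | P w].
    move=> /imsetP[v]; rewrite !in_sep => /andP[/mem_factors[k vk] Pv] -> /=.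
    by rewrite Pv andbT; apply/mem_factors; exists (2 * k + p); rewrite /= vk window_unfold.
  by case/orP; apply: sub.
have disj : f false @: A false :&: f true @: A true = set0; last first.
  rewrite cardsU disj cards0 subn0.
  by rewrite (card_imset _ (@f_inj false)) (card_imset _ (@f_inj true)).
apply/setP => w; rewrite in_setI in_set0; apply/negP => /andP[/imsetP[v +] -> /imsetP[u +]].
rewrite !in_sep => /andP[/mem_factors[k vk] _] /andP[/mem_factors[l ul] _] /(congr1 val) /=.
rewrite vk ul -!window_unfold.
by rewrite addn0; apply: window_parity.
Qed.

(** For the short lengths to which desubstitution does not apply: [idx] holds positions where the
    listed words occur. *)
Lemma card_factors_list N (idx : seq nat) (s : seq (seq bool)) (P : pred (seq bool)) :
  s = [seq window N i | i <- idx] -> uniq s -> (forall i, window N i \in s) ->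
  #|[set w in factors thue_morse N | P w]| = count P s.
Proof.
move=> sE s_uniq s_all; rewrite cardE -(size_map val) -size_filter.
apply/perm_size/uniq_perm; rewrite ?filter_uniq ?map_inj_uniq ?enum_uniq //; first exact: val_inj.
move=> w; rewrite mem_filter; apply/mapP/andP.
  move=> [v]; rewrite mem_enum in_sep => /andP[/mem_factors[i vi] Pv] -> /=.
  by rewrite Pv vi.
move=> [Pw]; rewrite {1}sE => /mapP[i _ wi].
have sz : size w == N by rewrite wi size_window.
exists (Tuple sz) => //; rewrite mem_enum in_sep Pw andbT.
by apply/mem_factors; exists i.
Qed.

Ltac window_values :=
  rewrite /window /mkseq /= /thue_morse /ones ?big_ord_recr ?big_ord0; reflexivity.

Lemma card_factors0 (P : pred (seq bool)) :
  #|[set w in factors thue_morse 0 | P w]| = count P [:: [::]].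
Proof. by apply: (@card_factors_list 0 [:: 0]). Qed.

Lemma card_factors1 (P : pred (seq bool)) :
  #|[set w in factors thue_morse 1 | P w]| = count P [:: [:: false]; [:: true]].
Proof.
apply: (@card_factors_list 1 [:: 0; 1]) => //; first by window_values.
by move=> i; rewrite /window /mkseq /=; case: thue_morse.
Qed.

Lemma card_factors2 (P : pred (seq bool)) :
  #|[set w in factors thue_morse 2 | P w]| =
  count P [:: [:: false; true]; [:: true; true]; [:: true; false]; [:: false; false]].
Proof.
apply: (@card_factors_list 2 [:: 0; 1; 2; 5]) => //; first by window_values.
by move=> i; rewrite /window /mkseq /=; do 2!case: thue_morse.
Qed.

Lemma card_factors3 (P : pred (seq bool)) :
  #|[set w in factors thue_morse 3 | P w]| =
  count P [:: [:: false; true; true]; [:: true; true; false]; [:: true; false; true];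
              [:: false; true; false]; [:: true; false; false]; [:: false; false; true]].
Proof.
apply: (@card_factors_list 3 [:: 0; 1; 2; 3; 4; 5]) => //; first by window_values.
move=> i; rewrite /window /mkseq /= addn0 addn1 addn2.
(* This excludes the words 000 and 111, leaving six. *)
have := @thue_morse_cube_free i.
by do 3!case: thue_morse => //=; move=> H; case: (H erefl).
Qed.

(** * Recurrences for the complexity and for symmetric factors *)

Definition sym_complexity (c : bool) (N : nat) : nat :=
  #|[set w in factors thue_morse N | tval w == crev c w]|.

Local Notation rho := (subword_complexity thue_morse).

Lemma rhoE N : rho N = #|[set w in factors thue_morse N | xpredT (tval w)]|.
Proof. by apply: eq_card => w; rewrite in_sep andbT. Qed.

Lemma rho_rec N : 4 <= N -> rho N = rho (uphalf N) + rho N./2.+1.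
Proof.
move=> N4; have -> : uphalf N = parent_size N false by rewrite /parent_size addn0.
have -> : N./2.+1 = parent_size N true by rewrite /parent_size; lia.
by rewrite !rhoE; exact: (card_factors_unfold xpredT).
Qed.

Lemma rho_even n : 2 <= n -> rho (2 * n) = rho n + rho n.+1.
Proof. by move=> n2; rewrite rho_rec; [congr (rho _ + rho _.+1)|]; lia. Qed.

Lemma rho_odd n : 2 <= n -> rho (2 * n + 1) = 2 * rho n.+1.
Proof.
move=> n2; rewrite rho_rec; last by lia.
have -> : uphalf (2 * n + 1) = n.+1 by lia.
have -> : (2 * n + 1)./2 = n by lia.
by lia.
Qed.

Lemma rho_small : [/\ rho 0 = 1, rho 1 = 2, rho 2 = 4 & rho 3 = 6].
Proof.
split; rewrite rhoE.
- exact: (card_factors0 xpredT).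
- exact: (card_factors1 xpredT).
- exact: (card_factors2 xpredT).
- exact: (card_factors3 xpredT).
Qed.

Lemma sym_complexity_small :
  [/\ forall c, sym_complexity c 0 = 1,
      sym_complexity false 1 = 2 /\ sym_complexity true 1 = 0,
      forall c, sym_complexity c 2 = 2 &
      sym_complexity false 3 = 2 /\ sym_complexity true 3 = 0].
Proof.
rewrite /sym_complexity; split=> [c||c|].
- by rewrite (card_factors0 (fun w => w == crev c w)).
- by split; rewrite (card_factors1 (fun w => w == crev _ w)).
- by rewrite (card_factors2 (fun w => w == crev _ w)); case: c.
- by split; rewrite (card_factors3 (fun w => w == crev _ w)).
Qed.

(** At even length [crev] preserves the offset, so by injectivity of [unfold] a window has symmetry
    [c] exactly when its parent has the opposite one. *)
Lemma sym_complexity_even c n : 2 <= n ->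
  sym_complexity c (2 * n) = sym_complexity (~~ c) n + sym_complexity (~~ c) n.+1.
Proof.
move=> n2; rewrite /sym_complexity (card_factors_unfold (fun w => w == crev c w)); last by lia.
have E p : [set v in factors thue_morse (parent_size (2 * n) p) |
              unfold (2 * n) p v == crev c (unfold (2 * n) p v)] =
           [set v in factors thue_morse (parent_size (2 * n) p) | tval v == crev (~~ c) v].
  apply/setP => v; rewrite !in_sep; congr (_ && _).
  rewrite crev_unfold ?size_tuple // oddM addbF.
  apply/eqP/eqP => [|{1}->//]; apply: unfold_inj; rewrite ?size_crev ?size_tuple //; lia.
rewrite !E.
have -> : parent_size (2 * n) false = n by rewrite /parent_size; lia.
by have -> : parent_size (2 * n) true = n.+1 by rewrite /parent_size; lia.
Qed.

(** The central letter would be its own complement. *)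
Lemma sym_complexity_true_odd n : sym_complexity true (2 * n + 1) = 0.
Proof.
apply/eqP; rewrite cards_eq0; apply/eqP/setP => w; rewrite !inE; apply/negP => /andP[_ /eqP].
move=> /(congr1 (nth false ^~ n)); rewrite nth_crev size_tuple; last by lia.
have -> : 2 * n + 1 - n.+1 = n by lia.
by case: nth.
Qed.

(** The five central letters would form a palindrome. *)
Lemma sym_complexity_false_odd n : 2 <= n -> sym_complexity false (2 * n + 1) = 0.
Proof.
move=> n2.
apply/eqP; rewrite cards_eq0; apply/eqP/setP => w; rewrite in_sep in_set0.
apply/negP => /andP[/mem_factors[i ->] /eqP symw].
have E j : j <= 2 * n -> thue_morse (i + j) = thue_morse (i + (2 * n - j)).
  move=> lej; have ltj : j < 2 * n + 1 by lia.
  rewrite -(nth_window i ltj) symw nth_crev size_window // addbF nth_window; last by lia.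
  by congr thue_morse; lia.
have := @thue_morse_no_palindrome5 (i + (n - 2)).
have := E (n - 2); have := E (n - 1).
have -> : i + (2 * n - (n - 2)) = i + (n - 2) + 4 by lia.
have -> : i + (2 * n - (n - 1)) = i + (n - 2) + 3 by lia.
have -> : (i + (n - 2)).+1 = i + (n - 1) by lia.
by move=> E1 E2 H; apply: H; [apply: E2 | apply: E1]; lia.
Qed.

(** * Reflection complexity and the exceptional intervals *)

Lemma crev_factor N c (w : N.-tuple bool) :
  w \in factors thue_morse N -> [tuple of crev c w] \in factors thue_morse N.
Proof.
move=> /mem_factors[i wi]; apply/mem_factors; rewrite /= wi; exact: crev_window.
Qed.

Local Notation r := (reflection_complexity thue_morse).

Lemma crev_false (w : seq bool) : crev false w = rev w.
Proof. by rewrite /crev -[RHS]map_id; apply: eq_map => b; rewrite addbF. Qed.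

Lemma reflection_complexity_thue_morse N : 2 * r N = rho N + sym_complexity false N.
Proof.
rewrite reflection_complexity_palindromes; last first.
  move=> w wF; have := crev_factor false wF.
  by rewrite (_ : [tuple of crev false w] = [tuple of rev w]) //;
    apply: val_inj; exact: crev_false.
by congr (_ + _); apply: eq_card => w; rewrite !in_sep crev_false.
Qed.

(** This and the next lemma say, without truncated subtraction, that the first difference of [rho]
    is invariant under n -> ceil(n/2). *)
Lemma rho_step_odd n : 2 <= n -> rho (2 * n).+1 + rho n = rho (2 * n) + rho n.+1.
Proof. by move=> n2; rewrite -addn1 rho_odd // rho_even //; lia. Qed.

Lemma rho_step_even n : 2 <= n ->
  rho (2 * n).+2 + rho n.+1 = rho (2 * n).+1 + rho n.+2.
Proof.
move=> n2; have -> : (2 * n).+2 = 2 * n.+1 by lia.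
by rewrite -[(2 * n).+1]addn1 rho_odd // rho_even; lia.
Qed.

(** The range of part (b) with the exponent shifted by one; the lost case [m = 0], 7/4 <= n <= 1, is
    empty. *)
Definition bonus (n : nat) : bool := `[< exists m, 3 * 4 ^ m < n <= 4 ^ m.+1 >].

(** The numbers [4 * m - j] are those with ceil(n/4) = m. Interval bounds divisible by 4 shrink to
    the previous interval; the only other interval is {4}, excluded by [2 <= m]. *)
Lemma bonus4 (m j : nat) : 2 <= m -> j < 4 -> bonus (4 * m - j) = bonus m.
Proof.
move=> m2 j4; apply/asbool_equiv_eq; split=> [[[|k]]|[k]]; rewrite ?expnS ?expn0 => bk.
- by lia.
- by exists k; rewrite expnS; lia.
- by exists k.+1; rewrite !expnS; lia.
Qed.

Lemma bonus_small : [/\ bonus 2 = false, bonus 3 = false & bonus 4 = true].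
Proof.
by split; [apply/asboolP => -[m]; have := expn_gt0 4 m; lia ..
          | apply/asboolP; exists 0].
Qed.

Lemma sym_even_quarter m j : 2 <= m -> j < 4 -> 7 <= 4 * m - j ->
  sym_complexity false (2 * (4 * m - j)) = sym_complexity false (2 * m).
Proof.
move=> m2 j4 n7.
(* [2 * k] is the even one of n and n + 1, where n is [4 * m - j], and [2 * m] is the even one of
   [k] and [k + 1]. The odd ones contribute no symmetric factor, the second because it is at least
   5. *)
have [k [jk k3]] : exists k, (4 * m - j = 2 * k \/ (4 * m - j).+1 = 2 * k) /\
    3 < k /\ (k = 2 * m \/ k.+1 = 2 * m) by exists (2 * m - j./2); lia.
have -> : sym_complexity false (2 * (4 * m - j)) = sym_complexity true (2 * k).
  rewrite sym_complexity_even; last by lia.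
  case: jk => jk.
    by rewrite jk -[(2 * k).+1]addn1 sym_complexity_true_odd addn0.
  rewrite jk (_ : 4 * m - j = 2 * k.-1 + 1) ?sym_complexity_true_odd //; lia.
case: k3 => k3 km; rewrite sym_complexity_even; last by lia.
case: km => km.
  by rewrite km -[(2 * m).+1]addn1 sym_complexity_false_odd ?addn0.
by rewrite km (_ : k = 2 * m.-1 + 1) ?sym_complexity_false_odd //; lia.
Qed.

Lemma rho_diff_quarter m j : 2 <= m -> j < 4 -> 7 <= 4 * m - j ->
  rho (4 * m - j).+1 + rho m = rho (4 * m - j) + rho m.+1.
Proof.
move=> m2 j4 n7; have E1 := rho_step_odd m2.
have e : (2 * (m - 1)).+1 = 2 * m - 1 by lia.
have e1 : (m - 1).+1 = m by lia.
have e2 : (2 * m - 1).+1 = 2 * m by lia.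
(* Needed for [j] equal to 2 or 3, where [7 <= 4 * m - j] forces [3 <= m]. *)
have E2 : 3 <= m -> rho (2 * m) + rho m = rho (2 * m - 1) + rho m.+1.
  by move=> m3; have := @rho_step_even (m - 1) ltac:(lia); rewrite e e1 e2.
case: j j4 n7 => [|[|[|[|//]]]] _ n7.
- have := @rho_step_odd (2 * m) ltac:(lia).
  have -> : 4 * m - 0 = 2 * (2 * m) by lia.
  by lia.
- have := @rho_step_even (2 * m - 1) ltac:(lia).
  have -> : (2 * (2 * m - 1)).+1 = 4 * m - 1 by lia.
  by rewrite e2; lia.
- have := @rho_step_odd (2 * m - 1) ltac:(lia).
  have -> : 2 * (2 * m - 1) = 4 * m - 2 by lia.
  have := E2 ltac:(lia); rewrite e2; lia.
- have := @rho_step_even (2 * m - 2) ltac:(lia).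
  have -> : (2 * (2 * m - 2)).+1 = 4 * m - 3 by lia.
  have -> : (2 * m - 2).+1 = 2 * m - 1 by lia.
  have := E2 ltac:(lia); rewrite e2; lia.
Qed.

Lemma sym_even_bonus n : 2 <= n ->
  sym_complexity false (2 * n) + rho n = rho n.+1 + 2 * bonus n.
Proof.
elim/ltn_ind: n => n IH n2; have [n7|n6] := leqP 7 n.
  have [m [j [ltj nE]]] : exists m j, j < 4 /\ n = 4 * m - j.
    (* The quotient is ceil(n/4). *)
    by exists ((n + 3) %/ 4), (4 * ((n + 3) %/ 4) - n); lia.
  have m2 : 2 <= m by lia.
  rewrite nE in n7 *.
  have := rho_diff_quarter m2 ltj n7; have := IH m ltac:(lia) m2.
  by rewrite sym_even_quarter // bonus4 //; lia.
have [_ _ rho2 rho3] := rho_small.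
have rho4 : rho 4 = 10 by rewrite (rho_even (isT : 2 <= 2)) rho2 rho3.
have rho5 : rho 5 = 12 by rewrite (rho_odd (isT : 2 <= 2)) rho3.
have rho6 : rho 6 = 16 by rewrite (rho_even (isT : 2 <= 3)) rho3 rho4.
have rho7 : rho 7 = 20 by rewrite (rho_odd (isT : 2 <= 3)) rho4.
have [_ _ sym2 [sym3 sym3']] := sym_complexity_small.
have sym4 c : sym_complexity c 4 = if c then 4 else 2.
  rewrite (sym_complexity_even c (isT : 2 <= 2)) sym2; case: c; by rewrite ?sym3 ?sym3'.
have sym5 c : sym_complexity c 5 = 0.
  by case: c; [rewrite (sym_complexity_true_odd 2) | rewrite (@sym_complexity_false_odd 2)].
have sym6 c : sym_complexity c 6 = 4.
  rewrite (sym_complexity_even c (isT : 2 <= 3)) sym4; case: c; by rewrite ?sym3 ?sym3'.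
have sym7 c : sym_complexity c 7 = 0.
  by case: c; [rewrite (sym_complexity_true_odd 3) | rewrite (@sym_complexity_false_odd 3)].
have [b2 b3 b4] := bonus_small.
have b5 : bonus 5 = false by rewrite (@bonus4 2 3).
have b6 : bonus 6 = false by rewrite (@bonus4 2 2).
case: n n2 n6 {IH} => [|[|[|[|[|[|[|//]]]]]]] // _ _; rewrite sym_complexity_even //=.
- by rewrite sym2 sym3' b2 rho2 rho3.
- by rewrite sym4 sym3' b3 rho3 rho4.
- by rewrite sym4 sym5 b4 rho4 rho5.
- by rewrite sym6 sym5 b5 rho5 rho6.
- by rewrite sym6 sym7 b6 rho6 rho7.
Qed.

Lemma r_odd n : r (2 * n + 1) = rho n.+1.
Proof.
have := reflection_complexity_thue_morse (2 * n + 1).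
have [_ rho1 rho2 rho3] := rho_small; have [_ [sym1 _] _ [sym3 _]] := sym_complexity_small.
case: n => [|[|n]].
- by rewrite rho1 sym1; lia.
- by rewrite (_ : 2 * 1 + 1 = 3) // rho2 rho3 sym3; lia.
- by rewrite rho_odd // sym_complexity_false_odd //; lia.
Qed.

Lemma r_even n : 2 <= n -> r (2 * n) = rho n.+1 + bonus n.
Proof.
move=> n2; have := reflection_complexity_thue_morse (2 * n); rewrite rho_even //.
by have := sym_even_bonus n2; lia.
Qed.

Lemma bonusP (n : nat) :
  reflect (exists m : nat, (3%:Q * 4%:Q ^ (m%:Z - 1) + 1 <= n%:Q)%R /\ n <= 4 ^ m)
          (bonus n).
Proof.
have E k : (3%:Q * 4%:Q ^ (k.+1%:Z - 1) + 1 <= n%:Q)%R = (3 * 4 ^ k < n).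
  rewrite (_ : k.+1%:Z - 1 = k%:Z)%R; last by lia.
  by rewrite -exprnP -!pmulrn -natrX -natrM natr1 ler_nat.
apply/(iffP (asboolP _)) => -[m].
  by move=> /andP[lo hi]; exists m.+1; rewrite E.
case: m => [|m] [lo hi].
  (* For [m = 0] the rational power is 1/4, so the lower bound exceeds 1. *)
  have n1 : (n%:Q <= 1)%R by rewrite -[1%R]/(1%:~R)%R ler_int lez_nat -(expn0 4).
  by have := le_trans lo n1; rewrite sub0r gerDr.
by exists m; rewrite -E lo hi.
Qed.

(** * The automaton for the first difference *)

Local Notation d := (first_difference r).
Local Notation s := (first_difference rho).

Lemma diff_r_even n : 2 <= n -> d (2 * n) = (- (bonus n)%:Z)%R.
Proof. by move=> n2; rewrite /first_difference -addn1 r_odd r_even //; lia. Qed.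

Lemma diff_r_odd n : 1 <= n -> d (2 * n + 1) = (s n.+1 + (bonus n.+1)%:Z)%R.
Proof.
move=> n1; rewrite /first_difference r_odd (_ : (2 * n + 1).+1%N = (2 * n.+1)%N); last by lia.
by rewrite r_even //; lia.
Qed.

Lemma diff_rho_even n : 2 <= n -> s (2 * n) = s n.
Proof. by move=> n2; have := rho_step_odd n2; rewrite /first_difference; lia. Qed.

Lemma diff_rho_odd n : 2 <= n -> s (2 * n).+1 = s n.+1.
Proof. by move=> n2; have := rho_step_even n2; rewrite /first_difference; lia. Qed.

(** An odd number and its successor have the same ceil(n/4). *)
Lemma bonus_odd n : 2 <= n -> bonus (2 * n).+1 = bonus (2 * n.+1).
Proof.
move=> n2; have [m [j [-> -> m2 ltj]]] : exists m j,
    [/\ (2 * n).+1 = 4 * m - j.+1, 2 * n.+1 = 4 * m - j, 2 <= m & j.+1 < 4].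
  by exists ((n + 2) %/ 2), (2 * (odd n.+1)); split; lia.
by rewrite !bonus4 //; lia.
Qed.

(* profile n determines profile (2 * n) and profile (2 * n + 1), the first
   component being the output; the recurrences behind this start at n = 2, so 0
   and 1 carry only their value. *)
Definition profile (n : nat) : int * seq int :=
  (d n, if n < 2 then [:: n%:Z]%R
        else [:: s n; s n.+1; (bonus n)%:Z; (bonus n.+1)%:Z;
                 (bonus (2 * n))%:Z; (bonus (2 * n.+1))%:Z]%R).

(** Since [bonus] is invariant under n -> ceil(n/4), the values at [4 * n] and [4 * n + 2] are those
    at [n] and [n + 1]: the two bonus pairs exchange places. Profiles have one or six entries, so
    the last branch is a mere default. *)
Definition step (x : int * seq int) (b : bool) : int * seq int := (
  match x.2 with
  | [:: s0; s1; b0; b1; c0; c1] =>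
    if b then (s1 + b1, [:: s1; s1; c1; c1; b1; b1])
    else (- b0, [:: s0; s1; c0; c1; b0; b1])
  | [:: n] =>
    if n == 0 then (1, [:: b%:Z])
    else if b then (2, [:: 4; 2; 0; 1; 0; 0]) else (1, [:: 2; 4; 0; 0; 1; 0])
  | _ => x
  end)%R.

Lemma profile_step n (b : bool) : profile (2 * n + b) = step (profile n) b.
Proof.
case: (leqP 2 n) => [n2|n1]; last first.
  have [rho0 rho1 rho2 rho3] := rho_small.
  have rho4 : rho 4 = 10 by rewrite (rho_even (isT : 2 <= 2)) rho2 rho3.
  have rho5 : rho 5 = 12 by rewrite (rho_odd (isT : 2 <= 2)) rho3.
  have [b2 b3 b4] := bonus_small.
  have b6 : bonus 6 = false by rewrite (@bonus4 2 2).
  have b8 : bonus 8 = false by rewrite (@bonus4 2 0).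
  have r0 : r 0 = 1.
    have := reflection_complexity_thue_morse 0.
    by have [-> _ _ _] := sym_complexity_small; rewrite rho0; lia.
  have r2 : r 2 = 3.
    have := reflection_complexity_thue_morse 2.
    by have [_ _ -> _] := sym_complexity_small; rewrite rho2; lia.
  have r1 : r 1 = 2 by rewrite (r_odd 0).
  have r3 : r 3 = 4 by rewrite (r_odd 1).
  have r4 : r 4 = 6 by rewrite (@r_even 2) // rho3 b2.
  rewrite /profile /first_difference; case: n n1 => [|[|//]] _; case: b => /=.
  - by rewrite r0 r1 r2.
  - by rewrite r0 r1.
  - by rewrite r3 r4 rho3 rho4 rho5 b3 b4 b6 b8.
  - by rewrite r2 r3 b2 b3 b4 b6 rho2 rho3 rho4.
rewrite /profile !ifF; try lia.
have b4 : bonus (2 * (2 * n)) = bonus n by rewrite -[RHS](@bonus4 n 0) //; congr bonus; lia.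
have b4' i j : i = 4 * n.+1 - j -> j < 4 -> bonus i = bonus n.+1.
  by move=> -> j4; apply: bonus4; lia.
case: b; rewrite ?addn0 /step /=.
  rewrite diff_r_odd ?addn1; last by lia.
  have -> : (2 * n).+2 = 2 * n.+1 by lia.
  rewrite diff_rho_odd // diff_rho_even ?bonus_odd //; last by lia.
  by rewrite (b4' (2 * (2 * n).+1) 2) ?(b4' (2 * (2 * n.+1)) 0) //; lia.
rewrite diff_r_even // diff_rho_odd // diff_rho_even // bonus_odd // b4.
by rewrite (b4' (2 * (2 * n).+1) 2) //; lia.
Qed.

(** The orbit of [profile 0] under [step]: in order, the profiles of 0 to 8, 10, 12, 13, 14 and
    28. *)
Definition profiles : seq (int * seq int) :=
  [:: (1, [:: 0]); (1, [:: 1]);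
      (1, [:: 2; 4; 0; 0; 1; 0]); (2, [:: 4; 2; 0; 1; 0; 0]);
      (0, [:: 2; 4; 1; 0; 0; 0]); (4, [:: 4; 4; 0; 0; 0; 0]);
      (0, [:: 4; 2; 0; 0; 0; 1]); (3, [:: 2; 2; 0; 0; 1; 1]);
      (-1, [:: 2; 4; 0; 0; 1; 0]); (0, [:: 4; 4; 0; 0; 0; 0]);
      (0, [:: 4; 2; 0; 1; 0; 0]); (2, [:: 2; 2; 1; 1; 0; 0]);
      (0, [:: 2; 2; 1; 1; 0; 0]); (-1, [:: 2; 2; 0; 0; 1; 1])]%R.

Lemma step_profiles x b : x \in profiles -> step x b \in profiles.
Proof.
have /allP : all (fun y => (step y true \in profiles) && (step y false \in profiles)) profiles.
  by [].
by move=> /[apply] /andP[]; case: b.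
Qed.

Definition next (x : seq_sub profiles) (b : bool) : seq_sub profiles :=
  SeqSub (step_profiles b (valP x)).

Definition difference_dfao : dfao 2 int :=
  @Dfao 2 int (seq_sub profiles) (SeqSub (mem_head _ _ : (1, [:: 0])%R \in profiles))
    (fun x b => next x (b == 1 :> nat)) (fun x => (val x).1).

Lemma difference_dfao_computes : dfao_computes difference_dfao d.
Proof.
move=> n w <-; rewrite /dfao_eval /digits_value.
have init : val (dfao_init difference_dfao) = profile 0.
  rewrite /profile /first_difference (r_odd 0).
  have := reflection_complexity_thue_morse 0.
  have [-> rho1 _ _] := rho_small; have [-> _ _ _] := sym_complexity_small => r0.
  by rewrite rho1 (_ : r 0 = 1); last by lia.
(* The state always holds the profile of the value read so far; the start is generalized for
   induction on the word. *)
have run x m : val x = profile m ->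
    val (foldl (@dfao_trans _ _ difference_dfao) x w) =
    profile (foldl (fun (v : nat) (b : 'I_2) => v * 2 + b) m w).
  elim: w x m => [//|b w IH] x m xm /=; apply: IH; rewrite /= xm -profile_step.
  by congr profile; case: b => -[|[|]] //= _; lia.
by rewrite /= (run _ _ init).
Qed.

Lemma card_difference_dfao : #|dfao_state difference_dfao| = 14.
Proof. by rewrite card_seq_sub. Qed.

Theorem theorem8p2 :
  let rho := subword_complexity thue_morse in
  let r := reflection_complexity thue_morse in
  let in_range (n : nat) :=
    exists m : nat,
      (3%:Q * 4%:Q ^ (m%:Z - 1) + 1 <= n%:Q)%R /\ n <= 4 ^ m in
  [/\ forall n : nat, r (2 * n + 1) = rho (n + 1),
      forall n : nat, 2 <= n ->
        (in_range n -> r (2 * n) = rho (n + 1) + 1) /\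
        (~ in_range n -> r (2 * n) = rho (n + 1)),
      exists M : dfao 2 int,
        #|dfao_state M| = 14 /\ dfao_computes M (first_difference r)
    & automatic 2 (first_difference r)].
Proof.
have computes := difference_dfao_computes.
split=> [n|n n2||]; last by exists difference_dfao.
- by rewrite r_odd addn1.
- by rewrite r_even // !addn1; split=> [/bonusP -> | /bonusP/negPf ->]; lia.
- by exists difference_dfao; split; [exact: card_difference_dfao|].
Qed.
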